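(* Let $n\ge 3$ and let $BS_n$ be the $n$-dimensional bubble-sort star graph. Then $BS_n$ is $(2n-5)$-edge-fault-tolerant strongly Menger edge connected, i.e., for every $F_e\subseteq E(BS_n)$ with $|F_e|\le 2n-5$, the graph $BS_n-F_e$ is strongly Menger edge connected. Moreover, the bound $2n-5$ is sharp: there exists $F_e\subseteq E(BS_n)$ with $|F_e|=2n-4$ such that $BS_n-F_e$ is not strongly Menger edge connected.
   Context: The $n$-dimensional bubble-sort star graph $BS_n$ has as vertex set all permutations $x=x_1x_2\cdots x_n$ of $\{1,\dots,n\}$. Two distinct vertices $x,y$ are adjacent iff there is $k\in\{2,\dots,n\}$ such that $y$ is obtained from $x$ either by swapping the entries in positions $k-1$ and $k$, or by swapping the entries in positions $1$ and $k$. ($BS_n$ is bipartite and $(2n-3)$-regular with $n!$ vertices.) For $F_e\subseteq E(G)$, $G-F_e$ is the graph with vertex set $V(G)$ and edge set $E(G)\setminus F_e$. A graph $G$ is strongly Menger edge connected if for any two distinct vertices $u,v$ of $G$ there exist $\min\{d_G(u),d_G(v)\}$ pairwise edge-disjoint $(u,v)$-paths in $G$. For an integer $m\ge1$, $G$ is $m$-edge-fault-tolerant strongly Menger edge connected if $G-F_e$ is strongly Menger edge connected for every $F_e\subseteq E(G)$ with $|F_e|\le m$. *)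

(* Defs.v *)
From mathcomp Require Import all_boot all_fingroup.

Set Implicit Arguments.
Unset Strict Implicit.
Unset Printing Implicit Defensive.

Record sgraph := SGraph {
  vertex :> finType;
  adj : rel vertex;
  adj_sym : symmetric adj;
  adj_irr : irreflexive adj
}.

Section Graphs.
Variable G : sgraph.
Implicit Types (u v : G) (p : seq G) (F : {set {set G}}).

Definition edges : {set {set G}} :=
  [set [set e.1; e.2] | e : G * G & adj e.1 e.2].

Definition degree u : nat := #|[set v | adj u v]|.

Definition del_adj F : rel G :=
  fun u v => adj u v && ([set u; v] \notin F).

Lemma del_adj_sym F : symmetric (del_adj F).
Proof. by move=> u v; rewrite /del_adj adj_sym setUC. Qed.

Lemma del_adj_irr F : irreflexive (del_adj F).
Proof. by move=> u; rewrite /del_adj adj_irr. Qed.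

Definition del_edges F : sgraph := SGraph (del_adj_sym F) (del_adj_irr F).

(* The path from u to v is u :: p, as in the library's [path]. *)
Definition uv_path u v p : bool :=
  [&& path (@adj G) u p, last u p == v & uniq (u :: p)].

Definition path_edges u p : seq {set G} :=
  [seq [set e.1; e.2] | e <- zip (u :: p) p].

(* For u != v every path has an edge, so edge-disjoint paths are distinct. *)
Definition edge_disjoint_paths u v k : Prop :=
  exists P : 'I_k -> seq G,
    (forall i, uv_path u v (P i)) /\
    (forall i j, i != j ->
       [disjoint path_edges u (P i) & path_edges u (P j)]).

Definition strongly_menger_edge_connected : Prop :=
  forall u v, u != v -> edge_disjoint_paths u v (minn (degree u) (degree v)).

End Graphs.

Lemma edges_del (G : sgraph) (F : {set {set G}}) :
  edges (del_edges F) = edges G :\: F.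
Proof.
apply/setP=> A; rewrite inE; apply/imsetP/andP.
  case=> -[u v]; rewrite inE /= => /andP[uv uvF] ->; split=> //.
  by apply/imsetP; exists (u, v); rewrite ?inE.
case=> AF /imsetP[[u v]]; rewrite inE /= => uv eA.
by exists (u, v) => //; rewrite inE /= /del_adj uv -eA AF.
Qed.

Definition eft_strongly_menger (m : nat) (G : sgraph) : Prop :=
  forall F : {set {set G}}, F \subset edges G -> #|F| <= m ->
    strongly_menger_edge_connected (del_edges F).

Section BubbleSortStar.
Variable n : nat.

(* Positions and entries are numbered from 0: x : 'S_n is the word
   x 0, ..., x (n-1).  Permutations compose left to right, so that
   (tperm j k * x) i = x (tperm j k i) is x with the entries in positions
   j and k swapped. *)
Definition bs_adj : rel 'S_n := fun x y =>
  [exists k : 'I_n, (0 < k) &&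
    [exists j : 'I_n, ((j == k.-1 :> nat) || (j == 0 :> nat)) &&
       (y == (tperm j k * x)%g)]].

Lemma bs_adj_sym : symmetric bs_adj.
Proof.
suff H x y : bs_adj x y -> bs_adj y x by move=> x y; apply/idP/idP; apply: H.
case/existsP=> k /andP[k0 /existsP[j /andP[jk /eqP->]]].
apply/existsP; exists k; rewrite k0; apply/existsP; exists j; rewrite jk /=.
by rewrite mulgA tperm2 mul1g.
Qed.

Lemma bs_adj_irr : irreflexive bs_adj.
Proof.
move=> x; apply/negbTE/negP=> /existsP[k /andP[k0 /existsP[j /andP[jk /eqP E]]]].
have := congr1 (fun s : 'S_n => s j) E; rewrite permM tpermL => /perm_inj ejk.
by move: jk k0; rewrite ejk; case: (nat_of_ord k) => //= m; rewrite gtn_eqF.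
Qed.

Definition BS : sgraph := SGraph bs_adj_sym bs_adj_irr.

End BubbleSortStar.

(* Main.v *)
Require Import Defs.
From mathcomp Require Import all_boot all_order all_algebra all_fingroup.
From mathcomp Require Import zify.

(* Write d = 2n - 3 for the degree.  By the edge form of Menger's theorem it
   suffices to bound the edge boundary of every vertex set X separating u from v.
   When X or its complement is a singleton, the boundary in BS_n - F is the
   degree of u or of v.  Otherwise the boundary of X in BS_n has at least
   4n - 8 = 2d - 2 edges, so at least d of them survive the removal of d - 2.
   The bound 4n - 8 is proved by induction on n, cutting BS_n into the n copies
   of BS_(n-1) given by the last entry.  A copy that X meets properly contributes
   at least 2n - 5 edges.  A copy inside X and a copy outside X are joined by
   2 (n-2)! edges.  If no copy lies inside X (or, dually, outside), the edges
   leaving the few copies met by X make up the difference.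
   For sharpness, delete all edges at the identity but the one to a generator g:
   then g keeps degree d, but the edge from g to the identity is a dead end. *)

Set Implicit Arguments.
Unset Strict Implicit.
Unset Printing Implicit Defensive.
Import Order.TTheory GRing.Theory Num.Theory.

(** * Edge boundaries of the bubble-sort star graph *)

Section Cut.
Variable n : nat.
Implicit Types (x y g : 'S_n) (X : {set 'S_n}).
Local Open Scope group_scope.

(** The neighbours of the identity: $BS_n$ is a Cayley graph, with generators acting by
    multiplication on the left. *)
Definition bs_gens : {set 'S_n} := [set g | bs_adj 1 g].

Lemma bs_gensP g :
  reflect (exists k j : 'I_n, [/\ 0 < k, (j = k.-1 :> nat) \/ (j = 0 :> nat) & g = tperm j k])
          (g \in bs_gens).
Proof.
rewrite inE; apply: (iffP existsP).
  case=> k /andP[k0 /existsP[j /andP[jk /eqP->]]]; exists k, j.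
  by rewrite mulg1; split=> //; case/orP: jk => /eqP; [left | right].
case=> k [j [k0 jk ->]]; exists k; rewrite k0; apply/existsP; exists j.
by rewrite mulg1 eqxx andbT; case: jk => ->; rewrite eqxx ?orbT.
Qed.

Lemma bs_adjE x y : bs_adj x y = (y * x^-1 \in bs_gens).
Proof.
rewrite inE; apply: eq_existsb => k; congr (_ && _).
by apply: eq_existsb => j; rewrite mulg1 (can2_eq (mulgKV x) (mulgK x)).
Qed.

Lemma bs_gen_odd g : g \in bs_gens -> odd_perm g.
Proof.
case/bs_gensP=> k [j [k0 jk ->]]; rewrite odd_tperm; apply/eqP=> ejk.
by move: jk; rewrite ejk; lia.
Qed.

Lemma bs_gen_invol g : g \in bs_gens -> g * g = 1.
Proof. by case/bs_gensP=> k [j [_ _ ->]]; rewrite tperm2. Qed.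

(* Each boundary edge {x, g x} of X is counted once: from its end x in X. *)
Definition crossing g X := #|[set x in X | g * x \notin X]|.

Definition cut_size X := \sum_(g in bs_gens) crossing g X.

Lemma crossingE g X : crossing g X = \sum_x ((x \in X) && ((g * x)%g \notin X)).
Proof. by rewrite /crossing -sum1dep_card big_mkcond. Qed.

(** For an involution [g], the map [x -> g x] exchanges the inner and outer ends of the boundary
    edges. *)
Lemma crossingC g X : g * g = 1 -> crossing g (~: X) = crossing g X.
Proof.
move=> g2; have gK : involutive (mulg g) by move=> x; rewrite mulgA g2 mul1g.
rewrite !crossingE (reindex_inj (inv_inj gK)) /=.
by apply: eq_bigr => x _; rewrite !inE gK negbK andbC.
Qed.

Lemma cut_sizeC X : cut_size (~: X) = cut_size X.
Proof. by apply: eq_bigr => g gG; rewrite crossingC // bs_gen_invol. Qed.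

End Cut.

(** * Decomposition of permutations by their last entry *)

Section Slice.
Variable m : nat.
Local Open Scope group_scope.

Lemma lift_perm_inj (i j : 'I_m.+1) : injective (@lift_perm m i j).
Proof.
move=> s t /permP e; apply/permP=> k; apply: (@lift_inj _ j).
by rewrite -!(lift_perm_lift i) e.
Qed.

(** Injectivity is enough, since both sides have [(m+1)! = (m+1) m!] elements. *)
Lemma lift_perm_bij (i : 'I_m.+1) :
  bijective (fun q : 'I_m.+1 * 'S_m => lift_perm i q.1 q.2).
Proof.
apply: inj_card_bij.
  move=> [j s] [k t] /= e.
  have ejk : j = k by rewrite -(lift_perm_id i j s) e lift_perm_id.
  by move: e; rewrite ejk => /lift_perm_inj->.
by rewrite card_prod card_ord !card_Sn factS.
Qed.

Lemma sum_lift_perm (i : 'I_m.+1) (f : 'S_m.+1 -> nat) :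
  \sum_x f x = \sum_j \sum_s f (lift_perm i j s).
Proof.
by rewrite (reindex _ (onW_bij _ (lift_perm_bij i))) /= pair_bigA.
Qed.

Lemma card_perm_fixed_value (i j : 'I_m.+1) : #|[set s : 'S_m.+1 | s i == j]| = m`!.
Proof.
rewrite -sum1dep_card big_mkcond /= (sum_lift_perm i) (bigD1 j) //=.
rewrite [X in (_ + X)%N]big1 ?addn0 => [|k kj].
  rewrite (eq_bigr (fun=> 1%N)) => [|s _]; last by rewrite lift_perm_id eqxx.
  by rewrite sum_nat_const muln1 card_Sn.
by rewrite big1 // => s _; rewrite lift_perm_id (negbTE kj).
Qed.

Lemma lift_perm_tperm (i a b : 'I_m.+1) (a' b' : 'I_m) :
  a = lift i a' -> b = lift i b' -> lift_perm i i (tperm a' b') = tperm a b.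
Proof.
move=> -> ->; apply/permP=> k; case: (unliftP i k) => [k'|] ->.
  by rewrite lift_perm_lift inj_tperm //; apply: lift_inj.
by rewrite lift_perm_id tpermD // eq_sym neq_lift.
Qed.

(** The part of [X] in the copy with last entry [j], the other entries being relabelled to form a
    word of ['S_m]. *)
Definition slice (j : 'I_m.+1) (X : {set 'S_m.+1}) : {set 'S_m} :=
  [set s | lift_perm ord_max j s \in X].

Lemma card_slices (X : {set 'S_m.+1}) : #|X| = \sum_j #|slice j X|.
Proof.
rewrite -sum1_card big_mkcond /= (sum_lift_perm ord_max).
apply: eq_bigr => j _; rewrite -sum1_card [RHS]big_mkcond /=.
by apply: eq_bigr => s _; rewrite inE.
Qed.

(** A generator that fixes the last position keeps the last entry, so it acts inside each copy, as
    [g] does. *)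
Lemma crossing_slices g (X : {set 'S_m.+1}) :
  crossing (lift_perm ord_max ord_max g) X = \sum_j crossing g (slice j X).
Proof.
rewrite crossingE (sum_lift_perm ord_max); apply: eq_bigr => j _.
by rewrite crossingE; apply: eq_bigr => s _; rewrite lift_permM !inE.
Qed.

Lemma perm_as_lift (x : 'S_m.+1) : exists s, x = lift_perm ord_max (x ord_max) s.
Proof.
have [f _ fK] := lift_perm_bij (@ord_max m).
have := fK x; case: (f x) => j s /= <-; exists s; by rewrite lift_perm_id.
Qed.

Lemma in_slice x (X : {set 'S_m.+1}) :
  exists s, (x \in X) = (s \in slice (x ord_max) X).
Proof. by have [s {1}->] := perm_as_lift x; exists s; rewrite inE. Qed.

End Slice.

(** * The two generators that move the last position *)

Section GenSplit.
Variable m : nat.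
Local Open Scope group_scope.

Definition ord_penult : 'I_m.+2 := lift ord_max ord_max.
Definition star_top : 'S_m.+2 := tperm ord0 ord_max.
Definition bubble_top : 'S_m.+2 := tperm ord_penult ord_max.

(** If the last position is swapped, its partner is the first or the penultimate one; any other swap
    comes from the smaller graph. *)
Lemma bs_gens_split :
  bs_gens m.+2 =
    [set star_top; bubble_top] :|: [set lift_perm ord_max ord_max g | g in bs_gens m.+1].
Proof.
apply/setP=> g; rewrite in_setU in_set2.
apply/bs_gensP/orP.
  case=> k [j [k0 jk ->]]; case: (unliftP ord_max k) => [k' ek|ek].
    right; have jm : j != ord_max.
      apply/eqP=> ej; have := ltn_ord k'; move: jk.
      by rewrite ek ej lift_max /=; lia.
    case: (unliftP ord_max j) jm => [j' ej _|->]; last by rewrite eqxx.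
    apply/imsetP; exists (tperm j' k'); last by rewrite (lift_perm_tperm ej ek).
    apply/bs_gensP; exists k', j'; move: jk k0.
    by rewrite ek ej !lift_max.
  left; apply/orP; case: jk => ej; [right|left]; apply/eqP; congr tperm => //.
    by apply: val_inj; rewrite /= ej ek /= /bump leqNgt ltnSn.
  by apply: val_inj.
case=> [/orP[]/eqP->|/imsetP[h /bs_gensP[k [j [k0 jk ->]]] ->]].
- by exists ord_max, ord0; split=> //; right.
- by exists ord_max, ord_penult; split=> //; left; rewrite lift_max.
exists (lift ord_max k), (lift ord_max j); rewrite !lift_max; split=> //.
exact: lift_perm_tperm.
Qed.

(** For [m = 0] the first and the penultimate position coincide. *)
Lemma star_bubble_neq : 0 < m -> star_top != bubble_top.
Proof.
move=> m0; apply/eqP=> /permP/(_ ord_max); rewrite !tpermR => /(congr1 val).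
by rewrite /= /bump leqNgt ltnSn; lia.
Qed.

Lemma sum_bs_gens (f : 'S_m.+2 -> nat) : 0 < m ->
  \sum_(g in bs_gens m.+2) f g =
  (f star_top + f bubble_top + \sum_(g in bs_gens m.+1) f (lift_perm ord_max ord_max g))%N.
Proof.
move=> m0; rewrite bs_gens_split -setUA.
have nL (g : 'S_m.+2) : g ord_max != ord_max ->
    g \notin [set lift_perm ord_max ord_max h | h in bs_gens m.+1].
  by apply: contra => /imsetP[h _ ->]; rewrite lift_perm_id.
rewrite big_setU1 ?big_setU1 /= ?in_setU1 ?negb_or ?star_bubble_neq ?nL //.
- by rewrite big_imset ?addnA //= => g h _ _ /lift_perm_inj.
- by rewrite tpermR eq_sym neq_lift.
by rewrite tpermR.
Qed.

Lemma cut_size_slices (X : {set 'S_m.+2}) : 0 < m ->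
  cut_size X = (crossing star_top X + crossing bubble_top X
                + \sum_j cut_size (slice j X))%N.
Proof.
move=> m0; rewrite /cut_size sum_bs_gens //; congr (_ + _)%N.
rewrite exchange_big /=; apply: eq_bigr => g _; exact: crossing_slices.
Qed.

End GenSplit.

Lemma card_bs_gens m : #|bs_gens m.+2| = (2 * m).+1.
Proof.
elim: m => [|m IH].
  have e : star_top 0 = bubble_top 0 by congr tperm; apply: val_inj.
  have e0 : bs_gens 1 = set0.
    apply/setP=> g; rewrite in_set0; apply/negbTE/negP.
    by case/bs_gensP=> k [j [k0 _ _]]; have := ltn_ord k; lia.
  by rewrite bs_gens_split e0 imset0 setU0 e setUid cards1.
rewrite -sum1_card sum_bs_gens // sum1_card IH; lia.
Qed.

Lemma cut_size_set1 n (x : 'S_n) : cut_size [set x] = #|bs_gens n|.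
Proof.
rewrite -sum1_card; apply: eq_bigr => g gG; rewrite /crossing.
rewrite (_ : [set _ in _ | _] = [set x]) ?cards1 //; apply/setP=> y; rewrite !inE.
case: eqP => //= ->; rewrite eq_mulgV1 mulgK.
by apply/eqP=> g1; have := bs_gen_odd gG; rewrite g1 odd_perm1.
Qed.

(** A singleton or the complement of one has as boundary the degree [2m + 1]; all other proper sets
    fall under the hypothesis. *)
Lemma cut_size_proper m (Y : {set 'S_m.+2}) :
  (forall Z : {set 'S_m.+2}, 2 <= #|Z| -> #|Z| + 2 <= m.+2`! -> 4 * m <= cut_size Z) ->
  Y != set0 -> Y != setT -> 2 * m < cut_size Y.
Proof.
move=> H Y0 YT; have cY := cardsC Y; rewrite card_Sn in cY.
have Y1 : 0 < #|Y| by rewrite card_gt0.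
have Z1 : 0 < #|~: Y| by rewrite card_gt0 -(inj_eq (@setC_inj _)) setCK setC0.
case: (ltngtP #|Y| 1) => [|Y2|/eqP/cards1P[y ->]]; first by lia.
  case: (ltngtP #|~: Y| 1) => [|Z2|/eqP/cards1P[y e]]; first by lia.
    (* [4m] exceeds [2m] only for [m > 0]; for [m = 0] there are just two permutations, too few for
       this case. *)
    have f : m = 0 -> m.+2`! = 2 by move=> ->.
    by have := H Y Y2; case: (posnP m) => [/f|]; lia.
  by rewrite -(setCK Y) cut_sizeC e cut_size_set1 card_bs_gens.
by rewrite cut_size_set1 card_bs_gens.
Qed.

(** * Induction step for the lower bound on boundaries *)

Section CutStep.
Variables (m : nat) (X : {set 'S_m.+2}).
Local Open Scope group_scope.


Let full := [set j | slice j X == setT].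
Let empty := [set j | slice j X == set0].
Let mixed := ~: (full :|: empty).

Lemma full_mem (x : 'S_m.+2) : x ord_max \in full -> x \in X.
Proof. by rewrite inE => /eqP e; have [s ->] := in_slice x X; rewrite e inE. Qed.

Lemma empty_mem (x : 'S_m.+2) : x ord_max \in empty -> x \notin X.
Proof. by rewrite inE => /eqP e; have [s ->] := in_slice x X; rewrite e inE. Qed.

Lemma card_full_empty_mixed : (#|full| + #|empty| + #|mixed| = m.+2)%N.
Proof.
have d : full :&: empty = set0.
  apply/setP=> j; rewrite !inE; apply/negP=> /andP[/eqP-> /eqP/setP/(_ 1)].
  by rewrite !inE.
by have := cardsC (full :|: empty); rewrite cardsU d cards0 subn0 card_ord.
Qed.

(** For [j] full and [k] empty, the [m!] words with last entry [j] and entry [k] at the swapped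
    position lie in [X], and the swap sends them into the copy [k], out of [X]. *)
Lemma crossing_full_empty (a : 'I_m.+1) :
  (#|full| * #|empty| * m`! <= crossing (tperm (lift ord_max a) ord_max) X)%N.
Proof.
rewrite crossingE (sum_lift_perm ord_max) (bigID (mem full)) /=.
apply: leq_trans (leq_addr _ _); rewrite -mulnA -sum_nat_const.
apply: leq_sum => j jf.
rewrite -sum_nat_const.
have H k : k \in empty -> k != j.
  apply: contraTneq => ->; move: jf; rewrite !inE => /eqP->.
  by apply/eqP=> /setP/(_ 1); rewrite !inE.
(* [lift j (s a)] is the entry that the swap makes last. It names at most one empty copy, so after
   the exchange of sums each word counts at most once. *)
apply: (@leq_trans (\sum_(k in empty) \sum_(s : 'S_m.+1) (lift j (s a) == k))); last first.
  rewrite exchange_big; apply: leq_sum => s _ /=.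
  have [se|se] := boolP (lift j (s a) \in empty).
    rewrite (bigD1 (lift j (s a))) //= eqxx big1 => [|k /andP[_ /negbTE]]; last first.
      by rewrite eq_sym => ->.
    rewrite full_mem ?lift_perm_id // empty_mem //.
    by rewrite permM tpermR lift_perm_lift.
  by rewrite big1 // => k ke; case: eqP => // ek; rewrite ek ke in se.
apply: leq_sum => k ke.
case: (unliftP j k) (H _ ke) => [k' -> _|->]; last by rewrite eqxx.
rewrite -(card_perm_fixed_value a k') -sum1dep_card big_mkcond /=.
by apply: leq_sum => s _; rewrite (inj_eq lift_inj); case: eqP.
Qed.

Lemma empty_crossing (x : 'S_m.+2) (a : 'I_m.+2) :
  x a \in empty -> x \in X -> x \in [set x in X | tperm a ord_max * x \notin X].
Proof. by move=> xa xX; rewrite inE xX empty_mem // permM tpermR. Qed.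

Lemma cut_size_mixed k : 0 < m ->
  (forall Y : {set 'S_m.+1}, Y != set0 -> Y != setT -> k <= cut_size Y) ->
  crossing (star_top m) X + crossing (bubble_top m) X + #|mixed| * k <= cut_size X.
Proof.
move=> m0 H; rewrite cut_size_slices // leq_add2l -sum_nat_const.
rewrite [leqRHS](bigID (mem mixed)) /=.
apply: leq_trans (leq_addr _ _); apply: leq_sum => j.
by rewrite !inE negb_or => /andP[jT j0]; apply: H.
Qed.

End CutStep.

(* With two copies met by X, one of the two top generators leads from x to a
   third copy, since x ord0, x ord_penult and x ord_max are distinct. *)
Lemma cut_size_no_full m (X : {set 'S_m.+3}) : 0 < m ->
  (forall Y : {set 'S_m.+2}, 2 <= #|Y| -> #|Y| + 2 <= m.+2`! -> 4 * m <= cut_size Y) ->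
  (forall j, slice j X != setT) -> 2 <= #|X| -> 4 * m.+1 <= cut_size X.
Proof.
move=> m0 H nf X2.
have := cut_size_mixed X (ltn0Sn m) (fun Y => @cut_size_proper m Y H).
have := card_full_empty_mixed X.
set full := [set j | slice j X == setT]; set empty := [set j | slice j X == set0].
set mixed := ~: _.
have fE : full = set0 by apply/setP=> j; rewrite !inE (negbTE (nf j)).
have mixedE j : (j \in mixed) = (slice j X != set0) by rewrite !inE (negbTE (nf j)).
have memX (x : 'S_m.+3) : x \in X -> x ord_max \in mixed.
  move=> xX; rewrite mixedE; apply/set0Pn; have [s e] := in_slice x X.
  by exists s; rewrite -e.
have notmixed j : (j \in empty) = (j \notin mixed) by rewrite mixedE negbK inE.
rewrite fE cards0 => cE.
case: (ltngtP #|mixed| 2) => [M1|M3|M2]; last first.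
(* Two mixed copies give [2 (2m + 1)]; the two missing edges come from the words of [X], each of
   which leaves [X] by a top generator. *)
- move=> le; suff : #|X| <= crossing (star_top _) X + crossing (bubble_top _) X by lia.
  have /eqP/cards2P[a [b [ab eM]]] := M2.
  rewrite /crossing; apply: leq_trans (leq_card_setU _ _); apply/subset_leq_card/subsetP=> x xX.
  rewrite in_setU; apply/orP.
  have [n0|n0] := boolP (x ord0 \in empty); first by left; apply: empty_crossing.
  right; apply: empty_crossing => //; rewrite notmixed.
  move: n0 (memX _ xX); rewrite notmixed negbK eM !inE.
  have d1 : x ord0 != x ord_max by rewrite (inj_eq perm_inj).
  have d2 : x ord0 != x (ord_penult _).
    by rewrite (inj_eq perm_inj) -val_eqE [X in _ != X]lift_max.
  have d3 : x ord_max != x (ord_penult _) by rewrite (inj_eq perm_inj) neq_lift.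
  move=> /orP[]/eqP e0 /orP[]/eqP e1; move: d1 d2 d3; rewrite e0 e1 ?eqxx //.
  - by move=> _ d2 d3; rewrite negb_or eq_sym d2 eq_sym d3.
  - by move=> _ d2 d3; rewrite negb_or eq_sym d3 eq_sym d2.
(* At least three mixed copies give [3 (2m + 1) >= 4m + 4], as [m > 0]. *)
- by move=> le; nia.
have [X0|/set0Pn[x xX]] := eqVneq X set0; first by rewrite X0 cards0 in X2.
have xM := memX _ xX.
have eM : mixed = [set x ord_max].
  by apply/esym/eqP; rewrite eqEcard sub1set xM cards1; lia.
have cr (a : 'I_m.+3) : a != ord_max -> #|X| <= crossing (tperm a ord_max) X.
  move=> na; apply/subset_leq_card/subsetP=> y yX; apply: empty_crossing => //.
  move: (memX _ yX); rewrite notmixed eM !inE => /eqP <-.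
  by rewrite (inj_eq perm_inj).
have c0 : #|X| <= crossing (star_top _) X by apply: cr.
have c1 : #|X| <= crossing (bubble_top _) X by apply: cr; rewrite eq_sym neq_lift.
have cX : #|X| = #|slice (x ord_max) X|.
  rewrite card_slices (bigD1 (x ord_max)) //= big1 ?addn0 // => j jx.
  by apply/eqP; rewrite cards_eq0 -[_ == _]negbK -mixedE eM inE.
(* Within a single copy every word leaves by both top generators, which gives [2 #|X|] edges. If [X]
   misses at least two words of the copy, induction adds [4m]; otherwise [#|X| >= (m+2)! - 1] is
   large enough. *)
case: (leqP (#|X| + 2) m.+2`!) => Xm.
  move=> _; rewrite cut_size_slices // (bigD1 (x ord_max)) //=.
  have := H (slice (x ord_max) X); rewrite -cX => /(_ X2 Xm); lia.
rewrite eM cards1 => le.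
have : m.+2 * 2 <= m.+2`!.
  rewrite factS leq_mul2l /= factS; have := fact_gt0 m; nia.
lia.
Qed.

Lemma sliceC m (X : {set 'S_m.+1}) j : slice j (~: X) = ~: slice j X.
Proof. by apply/setP=> s; rewrite !inE. Qed.

Lemma cut_size_step m : 0 < m ->
  (forall Y : {set 'S_m.+2}, 2 <= #|Y| -> #|Y| + 2 <= m.+2`! -> 4 * m <= cut_size Y) ->
  forall X : {set 'S_m.+3}, 2 <= #|X| -> #|X| + 2 <= m.+3`! -> 4 * m.+1 <= cut_size X.
Proof.
move=> m0 H X X2 Xm.
have [/existsP[j jf]|/existsPn nf] := boolP [exists j, slice j X == setT]; last first.
  exact: cut_size_no_full.
(* If no copy is disjoint from [X], none lies inside the complement, which has the same boundary. *)
have [/existsP[k ke]|/existsPn ne] := boolP [exists j, slice j X == set0]; last first.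
  rewrite -cut_sizeC; apply: cut_size_no_full => // [k|].
    by rewrite sliceC -(inj_eq (@setC_inj _)) setCK setCT.
  by have := cardsC X; rewrite card_Sn; lia.
have := cut_size_mixed X (ltn0Sn m) (fun Y => @cut_size_proper m Y H).
have := crossing_full_empty X ord_max; have := crossing_full_empty X ord0.
rewrite (_ : lift ord_max ord0 = ord0); last exact: val_inj.
have := card_full_empty_mixed X.
set full := [set j | slice j X == setT]; set empty := [set j | slice j X == set0].
set mixed := ~: _.
rewrite -/(star_top _) -/(ord_penult _) -/(bubble_top _).
have f1 : 0 < #|full| by apply/card_gt0P; exists j; rewrite inE.
have e1 : 0 < #|empty| by apply/card_gt0P; exists k; rewrite inE.
have : 2 <= m.+1`! by rewrite factS; have := fact_gt0 m; nia.
move: (#|full|) (#|empty|) (#|mixed|) (m.+1`!) (crossing _ _) (crossing _ _) f1 e1 => f e c p a b.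
move=> f1 e1 p2 efm ha hb hX.
(* With [p >= 2], both top generators together give [2 f e p >= 4 (f + e - 1)], and
   [f + e = m + 3 - c]. The total [4 (m + 2 - c) + c (2m + 1)] suffices for [c <= 2]; three mixed
   copies suffice alone. *)
have fe : f + e - 1 <= f * e by nia.
have : f * e * 2 <= f * e * p by rewrite leq_mul2l p2 orbT.
case: c efm hX => [|[|[|c]]] efm hX; nia.
Qed.

(** * Base case: $BS_3$ is the complete bipartite graph $K_{3,3}$ *)

Lemma card_odd_S3 : #|[set g : 'S_3 | odd_perm g]| = 3.
Proof.
set O := [set g | _]; pose t : 'S_3 := tperm ord0 ord_max.
have E : ~: O = [set (t * g)%g | g in O].
  apply/setP=> g; rewrite !inE; apply/idP/imsetP=> [ge|[h ho ->]].
    exists (t * g)%g; last by rewrite mulgA tperm2 mul1g.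
    by rewrite inE odd_permM odd_tperm /= ge.
  by rewrite odd_permM odd_tperm /=; move: ho; rewrite inE => ->.
have := cardsC O; rewrite E card_imset; last exact: mulgI.
by rewrite card_Sn (_ : 3`! = 6) //; lia.
Qed.

(** Generators are odd, and there are three of them, as many as odd permutations in ['S_3]. *)
Lemma bs_gens3 : bs_gens 3 = [set g | odd_perm g].
Proof.
apply/eqP; rewrite eqEcard card_odd_S3 card_bs_gens andbT.
by apply/subsetP=> g /bs_gen_odd; rewrite [in X in _ -> X]inE.
Qed.

Lemma cut_size_sum_out n (X : {set 'S_n}) :
  cut_size X = \sum_(x in X) #|[set y in ~: X | bs_adj x y]|.
Proof.
rewrite /cut_size; under eq_bigr do rewrite crossingE.
rewrite exchange_big [RHS]big_mkcond /=; apply: eq_bigr => x _.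
case: ifP => xX; last by rewrite big1.
rewrite -sum1dep_card big_mkcond [RHS]big_mkcond /=.
rewrite [RHS](reindex_inj (mulIg x)) /=; apply: eq_bigr => g _.
by rewrite bs_adjE mulgK !inE; case: bs_adj; case: ((g * x)%g \in X).
Qed.

(** With [a] odd and [b] even words in [X], the boundary in $K_{3,3}$ is [a (3 - b) + b (3 - a)],
    which is at least 4 when [2 <= a + b <= 4]. *)
Lemma cut_size_S3 (X : {set 'S_3}) :
  2 <= #|X| -> #|X| + 2 <= 3`! -> 4 <= cut_size X.
Proof.
move=> X2 X4; rewrite cut_size_sum_out.
pose O := [set g : 'S_3 | odd_perm g].
have adjE (x y : 'S_3) : bs_adj x y = (odd_perm x != odd_perm y).
  by rewrite bs_adjE bs_gens3 inE odd_permM odd_permV addbC; do 2!case: odd_perm.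
have cO : #|O| = 3 := card_odd_S3.
have cE : #|~: O| = 3 by have := cardsC O; rewrite cO card_Sn (_ : 3`! = 6) //; lia.
rewrite (big_setID O) /=.
rewrite (eq_bigr (fun=> #|~: O :\: X|)) => [|x]; last first.
  rewrite !inE => /andP[_ xo]; congr #|pred_of_set _|; apply/setP=> y.
  by rewrite !inE adjE xo; case: odd_perm; case: (y \in X).
rewrite [X in _ + X](eq_bigr (fun=> #|O :\: X|)) => [|x]; last first.
  rewrite !inE => /andP[xo _]; congr #|pred_of_set _|; apply/setP=> y.
  by rewrite !inE adjE (negbTE xo); case: odd_perm; case: (y \in X).
rewrite !sum_nat_const.
have := cardsID O X; have := cardsID X O; have := cardsID X (~: O).
rewrite cO cE [~: O :&: X]setIC -setDE [O :&: X]setIC (_ : 3`! = 6) // in X4 *.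
move: #|X :&: O| #|X :\: O| #|O :\: X| #|~: O :\: X| #|X| X2 X4 => a b c d s s2 s4 h1 h2 h3.
have -> : d = 3 - b by lia.
have -> : c = 3 - a by lia.
have : a <= 3 by lia.
have : b <= 3 by lia.
by move: a b h1 h2 h3 => [|[|[|[|a]]]] [|[|[|[|b]]]]; lia.
Qed.

Lemma cut_size_bound m (X : {set 'S_m.+3}) :
  2 <= #|X| -> #|X| + 2 <= m.+3`! -> 4 * m.+1 <= cut_size X.
Proof.
elim: m X => [|m IH] X; first exact: cut_size_S3.
exact: cut_size_step.
Qed.

(** * The edge form of Menger's theorem *)

Section Arcs.
Variable T : finType.
Implicit Types (x y u v : T) (p : seq T).

Definition arcs u p : seq (T * T) := zip (u :: p) p.

Lemma arcs_cons u a p : arcs u (a :: p) = (u, a) :: arcs a p.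
Proof. by []. Qed.

Lemma mem_arcs u p x y : (x, y) \in arcs u p -> x \in u :: p /\ y \in p.
Proof.
elim: p u => [|a p IH] u //; rewrite arcs_cons inE => /orP[/eqP[-> ->]|/IH[xp yp]].
  by rewrite !mem_head.
by split; rewrite inE ?xp ?yp orbT.
Qed.

Lemma arcs_asym u p x y : uniq (u :: p) -> (x, y) \in arcs u p -> (y, x) \notin arcs u p.
Proof.
elim: p u => [|a p IH] u //; rewrite arcs_cons cons_uniq => /andP[up ap].
rewrite !inE => /orP[/eqP[ex ey]|xy]; last first.
  rewrite negb_or IH // andbT; apply: contra up => /eqP[<- _].
  by have [_ yp] := mem_arcs xy; rewrite inE yp orbT.
rewrite negb_or; apply/andP; split.
  by apply: contra up => /eqP[<- _]; rewrite ey mem_head.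
apply: contra up => /mem_arcs[_]; rewrite ex => h; by rewrite inE h orbT.
Qed.

Lemma path_arcs (e : rel T) u p x y : path e u p -> (x, y) \in arcs u p -> e x y.
Proof.
elim: p u => [|a p IH] u //= /andP[ua ap]; rewrite inE => /orP[/eqP[-> ->]|] //.
exact: IH.
Qed.

Local Open Scope ring_scope.

Definition path_flow u p x y : int := ((x, y) \in arcs u p)%:R - ((y, x) \in arcs u p)%:R.

(** Induction on the path: its first arc [(u, a)] is new because [u] does not recur, and it moves
    the source from [a] to [u]. *)
Lemma path_flow_net u p x : uniq (u :: p) ->
  \sum_y path_flow u p x y = (x == u)%:R - (x == last u p)%:R.
Proof.
elim: p u => [|a p IH] u up; first by rewrite big1 ?subrr.
have ap : uniq (a :: p) by case/andP: up.
have nu : u \notin a :: p by case/andP: up.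
have E y : path_flow u (a :: p) x y =
    path_flow a p x y + ((x == u)%:R * (y == a)%:R - (x == a)%:R * (y == u)%:R).
  have H z w : ((z, w) \in arcs u (a :: p))%:R =
      ((z, w) \in arcs a p)%:R + (z == u)%:R * (w == a)%:R :> int.
    rewrite arcs_cons inE xpair_eqE; have [->|zu] /= := eqVneq z u; last by rewrite mul0r addr0.
    have [->|wa] /= := eqVneq w a; last by rewrite mulr0 addr0.
    rewrite (_ : (u, a) \in _ = false) ?add0r ?mulr1 //.
    by apply/negP=> /mem_arcs[]; rewrite (negbTE nu).
  by rewrite /path_flow !H opprD addrACA [(y == u)%:R * _]mulrC.
have S (b : T) (c : int) : \sum_y c * (y == b)%:R = c.
  by rewrite (bigD1 b) //= eqxx mulr1 big1 ?addr0 // => y /negbTE->; rewrite mulr0.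
under eq_bigr do rewrite E.
rewrite big_split /= IH // sumrB !S /=.
by rewrite addrC addrA subrK.
Qed.

End Arcs.

(** * Integral maximum flow and its decomposition into paths *)

Section Flow.
Variable G : sgraph.
Variables u v : G.
Hypothesis uv : u != v.
Local Open Scope ring_scope.

(* A net flow: the skew-symmetric f x y counts the arc (x, y) positively and the
   arc (y, x) negatively, so cancellation on augmentation is automatic. *)
Definition flow (k : nat) (f : G -> G -> int) : Prop :=
  [/\ forall x y, f y x = - f x y,
      forall x y, f x y <= (adj x y)%:R
    & forall x, \sum_y f x y = k%:R * ((x == u)%:R - (x == v)%:R)].

(** Summing the net outflow over [X] gives [k], and the terms inside [X] cancel by skew-symmetry. *)
Lemma flow_across k f (X : {set G}) : flow k f -> u \in X -> v \notin X ->
  \sum_(x in X) \sum_(y in ~: X) f x y = k%:R.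
Proof.
case=> fN _ fnet uX vX.
have in0 : \sum_(x in X) \sum_(y in X) f x y = 0.
  have E : \sum_(x in X) \sum_(y in X) f x y = - \sum_(x in X) \sum_(y in X) f x y.
    rewrite [LHS]exchange_big -sumrN; apply: eq_bigr => x _.
    by rewrite -sumrN; apply: eq_bigr => y _; rewrite fN.
  lia.
have : \sum_(x in X) \sum_y f x y = k%:R.
  under eq_bigr do rewrite fnet.
  rewrite (bigD1 u) //= eqxx (negbTE uv) subr0 mulr1 big1 ?addr0 // => x /andP[xX xu].
  by rewrite (negbTE xu) [x == v](negbTE _) ?subrr ?mulr0 //; apply: contraNneq vX => <-.
move=> <-; rewrite -[LHS]add0r -[X in X + _]in0 -big_split /=; apply: eq_bigr => x _.
rewrite [RHS](bigID (mem X)) /=; congr (_ + _).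
by apply: eq_bigl => y; rewrite inE.
Qed.

(** The cut is the set reachable from [u]. This serves both for residual arcs, to augment a flow,
    and for positive arcs, to decompose one. *)
Lemma reach_or_cut (r : rel G) :
  (exists p, [/\ path r u p, last u p = v & uniq (u :: p)]) \/
  (exists X : {set G}, [/\ u \in X, v \notin X & forall x y, x \in X -> y \notin X -> ~~ r x y]).
Proof.
have [/connectP[p up vl]|nc] := boolP (connect r u v).
  left; case/shortenP: up vl => q uq qU _ vl; exists q; by rewrite vl.
right; exists [set x | connect r u x]; rewrite !inE connect0; split=> // x y.
rewrite !inE => ux; apply: contra => xy; exact: connect_trans ux (connect1 xy).
Qed.

Lemma add_path_flow k f p :
  flow k f -> path [rel x y | f x y < (adj x y)%:R] u p -> last u p = v -> uniq (u :: p) ->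
  flow k.+1 (fun x y => f x y + path_flow u p x y).
Proof.
case=> fN fcap fnet up pv pU; split=> [x y|x y|x].
- rewrite fN /path_flow; lia.
- rewrite /path_flow; case xy: (_ \in _).
    have := path_arcs up xy; rewrite /= (negbTE (arcs_asym pU xy)); lia.
  by have := fcap x y; lia.
by rewrite big_split /= fnet path_flow_net // pv; lia.
Qed.

Lemma sub_path_flow k f p :
  flow k.+1 f -> path [rel x y | 0 < f x y] u p -> last u p = v -> uniq (u :: p) ->
  flow k (fun x y => f x y - path_flow u p x y).
Proof.
case=> fN fcap fnet up pv pU; split=> [x y|x y|x].
- rewrite fN /path_flow; lia.
- rewrite /path_flow; case yx: ((y, x) \in _).
    have /= := path_arcs up yx; rewrite (negbTE (arcs_asym pU yx)) fN.
    have := fcap y x; rewrite adj_sym; case: (adj x y); lia.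
  by have := fcap x y; lia.
rewrite sumrB fnet path_flow_net // pv; lia.
Qed.

(** Augment one unit at a time. Without an augmenting path, all edges leaving the reachable set are
    saturated, so the current value [j] equals a boundary of size at least [k > j]. *)
Lemma max_flow k :
  (forall X : {set G}, u \in X -> v \notin X ->
     (k <= \sum_(x in X) #|[set y in ~: X | adj x y]|)%N) ->
  exists f, flow k f.
Proof.
move=> H.
suff: forall j, (j <= k)%N -> exists f, flow j f by apply.
elim=> [|j IH] jk.
  exists (fun _ _ => 0); split=> [x y|x y|x]; rewrite ?oppr0 ?ler0n //.
  by rewrite big1 // mul0r.
have [f fF] := IH (ltnW jk).
have [[p [up pv pU]]|[X [uX vX XC]]] := reach_or_cut [rel x y | f x y < (adj x y)%:R].
  by eexists; apply: add_path_flow fF up pv pU.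
have := flow_across fF uX vX; have := H X uX vX.
have [fN fcap _] := fF.
have -> : \sum_(x in X) \sum_(y in ~: X) f x y
        = (\sum_(x in X) #|[set y in ~: X | adj x y]|)%N%:R.
  rewrite natr_sum; apply: eq_bigr => x xX.
  rewrite -sum1dep_card natr_sum [RHS]big_mkcondr /=.
  apply: eq_bigr => y; rewrite inE => yX.
  by have := XC x y xX yX; have := fcap x y; rewrite /=; case: (adj x y); lia.
lia.
Qed.

(** Peel off a path of positive arcs and recurse. Without such a path, no positive amount would
    leave the reachable set, although [k + 1] units must. *)
Lemma flow_paths k f : flow k f ->
  exists P : 'I_k -> seq G,
    [/\ forall i, uv_path u v (P i),
        forall i x y, (x, y) \in arcs u (P i) -> 0 < f x y
      & forall i j e, i != j -> e \in arcs u (P i) -> e \notin arcs u (P j)].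
Proof.
elim: k f => [|k IH] f fF; first by exists (fun=> [::]); split; case.
have [[p [up pv pU]]|[X [uX vX XC]]] := reach_or_cut [rel x y | 0 < f x y]; last first.
  have := flow_across fF uX vX.
  have : \sum_(x in X) \sum_(y in ~: X) f x y <= 0.
    rewrite -oppr_ge0 -sumrN sumr_ge0 // => x xX; rewrite -sumrN sumr_ge0 // => y.
    by rewrite inE => yX; have := XC x y xX yX; rewrite /=; lia.
  lia.
have [P [Pp Pf Pd]] := IH _ (sub_path_flow fF up pv pU).
have [fN fcap _] := fF.
have pf x y : (x, y) \in arcs u p -> 0 < f x y by move/(path_arcs up).
(* Arcs of [p] carry exactly one unit, so neither they nor their reverses are positive in the
   remaining flow. *)
have Pp0 i x y : (x, y) \in arcs u (P i) -> (x, y) \notin arcs u p /\ 0 < f x y.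
  move=> xy; have := Pf _ _ _ xy; rewrite /path_flow.
  case xyp: (_ \in arcs u p).
    have := fcap x y; rewrite (negbTE (arcs_asym pU xyp)); case: (adj x y); lia.
  case yxp: (_ \in arcs u p); last by lia.
  have := pf _ _ yxp; have := fcap y x; rewrite (fN x y); case: (adj y x); lia.
pose Q (i : 'I_k.+1) := if unlift ord0 i is Some j then P j else p.
exists Q; split.
- move=> i; rewrite /Q; case: unliftP => [j _|_]; first exact: Pp.
  rewrite /uv_path pv eqxx pU andbT andbT; apply: sub_path up => x y /=.
  by have := fcap x y; case: (adj x y) => //; lia.
- move=> i x y; rewrite /Q; case: unliftP => [j _ /Pp0[]|_] //; exact: pf.
move=> i j [x y]; rewrite /Q.
case: (unliftP ord0 i) => [i'|] ->; case: (unliftP ord0 j) => [j'|] -> //.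
- by rewrite (inj_eq lift_inj); apply: Pd.
- by move=> _ /Pp0[].
- by move=> _ xy; apply/negP=> /Pp0[]; rewrite xy.
Qed.

Theorem edge_menger k :
  (forall X : {set G}, u \in X -> v \notin X ->
     (k <= \sum_(x in X) #|[set y in ~: X | adj x y]|)%N) ->
  edge_disjoint_paths u v k.
Proof.
move=> /max_flow[f fF]; have [fN _ _] := fF.
have [P [Pp Pf Pd]] := flow_paths fF; exists P; split=> // i j ij.
rewrite disjoint_subset; apply/subsetP=> A /mapP[[a b] ab ->].
rewrite inE; apply/negP=> /mapP[[c d] cd] /= E.
(* A shared edge is traversed either in the same direction, against arc-disjointness, or in opposite
   ones, against skew-symmetry of a flow positive on both arcs. *)
have [e|e] : (c, d) = (a, b) \/ (c, d) = (b, a).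
- have nab : a != b by apply: contraTneq (Pf _ _ _ ab) => ->; have := fN b b; lia.
  have : a \in [set c; d] by rewrite -E set21.
  have : b \in [set c; d] by rewrite -E set22.
  rewrite !inE => /orP[]/eqP eb /orP[]/eqP ea; move: nab; rewrite ea eb ?eqxx // => _.
    by right.
  by left.
- by move: cd; rewrite e; apply/negP; apply: Pd ab.
by move: (Pf _ _ _ cd) (Pf _ _ _ ab); case: e => -> ->; rewrite (fN a b); lia.
Qed.

End Flow.

(** * Fault tolerance and its sharpness *)

Section GraphCut.
Variable G : sgraph.
Implicit Types (X : {set G}) (F : {set {set G}}).

Definition boundary X : nat := \sum_(x in X) #|[set y in ~: X | adj x y]|.

Lemma boundaryE X :
  boundary X = #|[set e : G * G | [&& e.1 \in X, e.2 \notin X & adj e.1 e.2]]|.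
Proof.
rewrite /boundary -sum1dep_card.
rewrite -(pair_big_dep (mem X) (fun x y => (y \notin X) && adj x y) (fun _ _ => 1)) /=.
by apply: eq_bigr => x _; rewrite -sum1dep_card; apply: eq_bigl => y; rewrite inE.
Qed.

Lemma degree_boundary (u : G) : degree u = boundary [set u].
Proof.
rewrite /boundary big_set1; apply: eq_card => y; rewrite !inE.
by case: eqVneq => // ->; rewrite adj_irr.
Qed.

Lemma boundaryC X : boundary (~: X) = boundary X.
Proof.
pose sw (e : G * G) := (e.2, e.1); have swI : injective sw by move=> [a b] [c d] [-> ->].
rewrite !boundaryE -(card_imset _ swI).
apply: eq_card => -[x y]; rewrite inE /=.
apply/imsetP/idP=> [[[a b]]|xy]; last exists (y, x) => //; last first.
  by move: xy; rewrite !inE /= negbK adj_sym => /and3P[-> -> ->].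
by rewrite !inE /= negbK adj_sym => /and3P[??? [-> ->]]; apply/and3P.
Qed.

End GraphCut.

(** The side of [X] orients each boundary edge, so distinct boundary arcs are distinct edges, and at
    most [#|F|] of them are deleted. *)
Lemma boundary_del_edges (G : sgraph) (F : {set {set G}}) (X : {set G}) :
  @boundary G X <= @boundary (del_edges F) X + #|F|.
Proof.
rewrite !boundaryE; set A := [set e | _]; set B := [set e | _].
pose pr (e : G * G) := [set e.1; e.2].
have prI : {in A &, injective pr}.
  move=> [a b] [c d]; rewrite !inE /= => /and3P[aX bX _] /and3P[cX dX _] /setP E.
  have := E a; have := E b; rewrite !inE !eqxx /= orbT.
  have -> : (b == c) = false by apply: contraNF bX => /eqP->.
  have -> : (a == d) = false by apply: contraNF dX => /eqP<-.
  by rewrite orbF /= => /esym/eqP-> /esym/eqP->.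
rewrite -(cardsID [set e | pr e \in F]) addnC; apply: leq_add.
  apply/subset_leq_card/subsetP=> e; rewrite !inE /= /del_adj -/(pr e).
  by case/andP=> -> /and3P[-> -> ->].
rewrite -(card_in_imset (f := pr)); last by apply: sub_in2 prI => e /setIP[].
by apply/subset_leq_card/subsetP=> _ /imsetP[e /setIP[_ +] ->]; rewrite inE.
Qed.

Lemma boundary_BS n (X : {set BS n}) : boundary X = cut_size X.
Proof. by rewrite cut_size_sum_out. Qed.

Lemma degree_BS m (x : BS m.+2) : degree x = (2 * m).+1.
Proof. by rewrite degree_boundary boundary_BS cut_size_set1 card_bs_gens. Qed.

Lemma degree_del_edges (G : sgraph) (F : {set {set G}}) (x : G) :
  @degree (del_edges F) x <= degree x.
Proof. by apply/subset_leq_card/subsetP=> y; rewrite !inE /= => /andP[]. Qed.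

Lemma BS_eft_strongly_menger m : eft_strongly_menger (2 * m).+1 (BS m.+3).
Proof.
move=> F _ Fm u v uv; apply: edge_menger => // X uX vX.
rewrite -[leqRHS]/(@boundary (del_edges F) X).
have cX := cardsC X; rewrite [RHS]card_Sn in cX.
have X1 : 0 < #|X| by apply/card_gt0P; exists u.
have Y1 : 0 < #|~: X| by apply/card_gt0P; exists v; rewrite inE.
case: (ltngtP #|X| 1) => [|X2|/eqP/cards1P[x eX]]; first by lia.
  case: (ltngtP #|~: X| 1) => [|Y2|/eqP/cards1P[y eY]]; first by lia.
    have := boundary_del_edges F X; rewrite boundary_BS.
    have := cut_size_bound X2; have := degree_del_edges F u; rewrite degree_BS.
    (* [4 (m + 1) - (2m + 1) = 2m + 3] is the degree in the undamaged graph. *)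
    move=> du /(_ _)cb bX; apply: leq_trans (geq_minl _ _) _.
    have {}cb : 4 * m.+1 <= cut_size X by apply: cb; rewrite -cX leq_add2l.
    by apply: leq_trans du _; lia.
  have ey : v = y by apply/set1P; rewrite -eY inE.
  by rewrite -(@boundaryC (del_edges F)) eY -ey -degree_boundary geq_minr.
have ex : u = x by apply/set1P; rewrite -eX.
by rewrite eX -ex -degree_boundary geq_minl.
Qed.

(** * Sharpness: isolating the identity up to one edge *)

Section Sharp.
Variables (n : nat) (g h : 'S_n).
Hypotheses (gG : g \in bs_gens n) (hG : h \in bs_gens n) (gh : g != h).
Local Open Scope group_scope.

Definition star_edges : {set {set BS n}} := [set [set 1; s] | s in bs_gens n :\ g].

Lemma bs_gen_neq1 s : s \in bs_gens n -> s != 1.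
Proof. by move=> /bs_gen_odd so; apply: contraTneq so => ->; rewrite odd_perm1. Qed.

Lemma star_edgesE (x y : 'S_n) : [set x; y] \in star_edges ->
  (x = 1 /\ y \in bs_gens n :\ g) \/ (y = 1 /\ x \in bs_gens n :\ g).
Proof.
case/imsetP=> s sG /setP E; have s1 : s != 1 by apply: bs_gen_neq1; case/setD1P: sG.
have := E x; have := E y; rewrite !inE !eqxx orbT /=.
move=> /esym/orP[]/eqP ey /esym/orP[]/eqP ex.
- have := E s; rewrite ex ey !inE eqxx orbT orbb => /eqP s1'.
  by rewrite s1' eqxx in s1.
- by right; move: sG; rewrite ex !inE.
- by left; move: sG; rewrite ey !inE.
have := E 1; rewrite ex ey !inE eqxx orbb /= => /eqP s1'.
by rewrite -s1' eqxx in s1.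
Qed.

Lemma star_edges_sub : star_edges \subset edges (BS n).
Proof.
apply/subsetP=> _ /imsetP[s /setD1P[_ sG] ->]; apply/imsetP; exists (1, s) => //.
by move: sG; rewrite !inE.
Qed.

Lemma card_star_edges : #|star_edges| = #|bs_gens n|.-1.
Proof.
rewrite card_in_imset; first by rewrite [in RHS](cardsD1 g) gG.
move=> s t sG tG /setP/(_ s); rewrite !inE eqxx orbT (negbTE (bs_gen_neq1 _)) /=.
  by move/esym/eqP.
by case/setD1P: sG.
Qed.

Lemma degree_away (x : BS n) : x != 1 -> x \notin bs_gens n :\ g ->
  @degree (del_edges star_edges) x = @degree (BS n) x.
Proof.
move=> x1 xG; apply: eq_card => y; rewrite !inE /= /del_adj /= andb_idr // => _.
apply/negP=> xy; case: (star_edgesE xy) => [[ex _]|[_ h']]; first by rewrite ex eqxx in x1.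
by rewrite h' in xG.
Qed.

(** The second end is [h * g], a neighbour of [g]. It is even and not the identity, so it keeps its
    full degree, as [g] does. Edge-disjoint paths in that number would use every edge at [g], also
    the one to the identity. *)
Lemma star_edges_not_menger :
  ~ strongly_menger_edge_connected (del_edges star_edges).
Proof.
pose G := del_edges star_edges.
have gE : g \notin bs_gens n :\ g by rewrite !inE eqxx.
have g1 := bs_gen_neq1 gG.
have hgE : ~~ odd_perm (h * g).
  by rewrite odd_permM !bs_gen_odd.
have hg1 : h * g != 1.
  apply: contra gh => /eqP hg.
  by rewrite -(mulKg h g) hg mulg1 -(inj_eq (mulgI h)) mulgV bs_gen_invol.
have hgG : h * g \notin bs_gens n.
  by apply: contra hgE => /bs_gen_odd.
have uv : g != h * g.
  by rewrite eq_sym -{2}[g]mul1g (inj_eq (mulIg g)) bs_gen_neq1.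
have dreg (x : BS n) : degree x = #|bs_gens n|.
  by rewrite degree_boundary boundary_BS cut_size_set1.
move=> /(_ g (h * g) uv).
rewrite !degree_away ?dreg ?minnn //; last by rewrite in_setD1 (negbTE hgG) andbF.
case=> P [Pp Pd].
(* The first vertex after [g]. The default [1] is never returned, since by [Pne] the paths are
   nonempty; this matters because [1] is the vertex to be found among these values. *)
pose f i := head 1 (P i).
have Pne i : exists y p, P i = y :: p.
  case: (P i) (Pp i) => [|y p _]; last by exists y, p.
  by rewrite /uv_path /= andbT (negbTE uv).
have fI : injective f.
  move=> i j fij; apply/eqP/negPn/negP=> /(Pd i j).
  have [y [p ei]] := Pne i; have [z [q ej]] := Pne j.
  move: fij; rewrite /f ei ej /= => ->; rewrite disjoint_has /path_edges /=.
  by rewrite inE eqxx.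
have fN : [set f i | i : 'I_#|bs_gens n|] = [set y : G | @adj G g y].
  apply/eqP; rewrite eqEcard card_imset // card_ord; apply/andP; split.
    apply/subsetP=> _ /imsetP[i _ ->]; rewrite inE.
    have [y [p e]] := Pne i; have := Pp i; rewrite /f e /uv_path /=.
    by case/and3P=> /andP[].
  by rewrite -[X in X <= _]/(@degree G g) degree_away ?dreg.
have : 1 \in [set y : G | @adj G g y].
  rewrite inE /= /del_adj /= bs_adj_sym; apply/andP; split; first by move: gG; rewrite inE.
  apply/negP=> xy; case: (star_edgesE xy) => [[e _]|[_]]; first by rewrite e eqxx in g1.
  by rewrite (negbTE gE).
rewrite -fN => /imsetP[i _ e1]; have [y [p e]] := Pne i; have := Pp i.
move: e1; rewrite /f e /= => <- {e} /and3P[/= /andP[_]].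
(* The path cannot end at the identity, and it could leave it only by going back to [g], which a
   simple path forbids. *)
case: p => [_ /= /eqP e2|z q /= /andP[/andP[az nz] _] _]; first by rewrite -e2 eqxx in hg1.
have -> : z = g.
  apply/eqP; apply: contraNT nz => zg; apply/imsetP; exists z => //.
  by move: az; rewrite 2!inE zg inE.
by rewrite !inE eqxx orbT.
Qed.

End Sharp.

Theorem theorem3p1 (n : nat) (hn : 3 <= n) :
  eft_strongly_menger (2 * n - 5) (BS n) /\
  exists F : {set {set BS n}},
    [/\ F \subset edges (BS n), #|F| = 2 * n - 4
      & ~ strongly_menger_edge_connected (del_edges F)].
Proof.
case: n hn => [|[|[|m]]] // _; split.
  by have := @BS_eft_strongly_menger m; rewrite (_ : _.+1 = 2 * m.+3 - 5) //; lia.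
have sG : star_top m.+1 \in bs_gens m.+3 by rewrite bs_gens_split !inE eqxx.
have bG : bubble_top m.+1 \in bs_gens m.+3 by rewrite bs_gens_split !inE eqxx orbT.
exists (star_edges (star_top m.+1)); split.
- exact: star_edges_sub.
- rewrite card_star_edges // card_bs_gens; lia.
exact: star_edges_not_menger sG bG (star_bubble_neq _).
Qed.
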